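(* Every $10\times 5$ binary $3$-covering array is equivalent to $$\begin{pmatrix}1&0&0&0&0\\1&0&1&1&1\\1&1&0&1&1\\1&1&1&0&1\\1&1&1&1&0\\0&1&0&0&0\\0&0&1&0&0\\0&0&0&1&0\\0&0&0&0&1\\0&1&1&1&1\end{pmatrix}.$$
   Context: A binary $t$-covering array of size $m$ and degree $n$ is an $m\times n$ matrix with entries in $\{0,1\}$ such that for any $t$ distinct columns, all $2^t$ binary vectors of length $t$ occur at least once as the restriction of some row to those columns. Two binary matrices are equivalent if one can be transformed into the other by a sequence of row permutations, column permutations, and complementations of individual columns (swapping $0$ and $1$ in that column). *)

(* Defs.v *)
From mathcomp Require Import all_boot all_fingroup all_algebra.

Set Implicit Arguments.
Unset Strict Implicit.
Unset Printing Implicit Defensive.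

(* 'M[bool]_(m, n): the entry 0 is false, the entry 1 is true. *)

Definition covering_array (t m n : nat) (A : 'M[bool]_(m, n)) : Prop :=
  forall (c : 'I_t -> 'I_n) (v : 'I_t -> bool), injective c ->
  exists i : 'I_m, forall k : 'I_t, A i (c k) = v k.

Definition compl_col (m n : nat) (j0 : 'I_n) (A : 'M[bool]_(m, n)) :
    'M[bool]_(m, n) :=
  \matrix_(i, j) (if j == j0 then ~~ A i j else A i j).

Inductive ca_equiv (m n : nat) (A : 'M[bool]_(m, n)) : 'M[bool]_(m, n) -> Prop :=
| ca_equiv_refl : ca_equiv A A
| ca_equiv_row_perm (s : 'S_m) (B : 'M[bool]_(m, n)) :
    ca_equiv A B -> ca_equiv A (row_perm s B)
| ca_equiv_col_perm (s : 'S_n) (B : 'M[bool]_(m, n)) :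
    ca_equiv A B -> ca_equiv A (col_perm s B)
| ca_equiv_compl_col (j : 'I_n) (B : 'M[bool]_(m, n)) :
    ca_equiv A B -> ca_equiv A (compl_col j B).

Definition ca_10_5_rows : seq (seq nat) :=
  [:: [:: 1; 0; 0; 0; 0];
      [:: 1; 0; 1; 1; 1];
      [:: 1; 1; 0; 1; 1];
      [:: 1; 1; 1; 0; 1];
      [:: 1; 1; 1; 1; 0];
      [:: 0; 1; 0; 0; 0];
      [:: 0; 0; 1; 0; 0];
      [:: 0; 0; 0; 1; 0];
      [:: 0; 0; 0; 0; 1];
      [:: 0; 1; 1; 1; 1]].

Definition ca_10_5 : 'M[bool]_(10, 5) :=
  \matrix_(i < 10, j < 5) (nth 0 (nth [::] ca_10_5_rows i) j == 1).

(* Main.v *)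
Require Import Defs.
From mathcomp Require Import all_boot all_fingroup all_algebra.

(** Fix the first column. The rows where it takes a given value form a
    2-covering array on the other four columns, so there are at least five of
    them, hence exactly five for each value. A 5 x 4 binary 2-covering array has
    rows s, s + 0111, s + 1011, s + 1101, s + 1110 for some s: up to complement
    its columns are 2-subsets of five points, pairwise meeting in one point, and
    four such subsets form a star. Coverage of the triples among the last four
    columns then forces the centre of one half to be the complement of the
    centre of the other, so complementing columns according to s yields the
    displayed array up to a row permutation. *)

(** * Enumeration of pairwise 2-covering columns *)

Fixpoint bitseqs (k : nat) : seq bitseq :=
  if k is k'.+1 then map (cons false) (bitseqs k') ++ map (cons true) (bitseqs k')
  else [:: [::]].

Lemma mem_bitseqs (s : bitseq) : s \in bitseqs (size s).
Proof.
elim: s => //= -[] s IH; rewrite mem_cat.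
  by apply/orP; right; rewrite map_f.
by rewrite map_f.
Qed.

Definition covers2 (c d : bitseq) : bool :=
  all (fun v => v \in zip c d)
    [:: (false, false); (false, true); (true, false); (true, true)].

(** Columns are added one at a time and incompatible ones dropped at once, which keeps the
    enumeration small enough for [vm_compute]. *)
Fixpoint covering_families (k n : nat) : seq (seq bitseq) :=
  if n is n'.+1 then
    flatten [seq [seq c :: cs | c <- bitseqs k & all (covers2 c) cs]
            | cs <- covering_families k n']
  else [:: [::]].

Lemma mem_covering_families (k : nat) (cs : seq bitseq) :
  all (fun c => size c == k) cs -> pairwise covers2 cs ->
  cs \in covering_families k (size cs).
Proof.
elim: cs => //= c cs IH /andP[/eqP sc scs] /andP[ccs pcs].
apply/flatten_mapP; exists cs; first exact: IH.
by rewrite map_f // mem_filter ccs -sc mem_bitseqs.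
Qed.

Lemma covering_families_small (k : nat) :
  k < 5 -> covering_families k 4 = [::].
Proof. by case: k => [|[|[|[|[|]]]]] // _; vm_compute. Qed.

Definition xorseq (s r : bitseq) : bitseq := [seq p.1 (+) p.2 | p <- zip s r].

(** Up to complement, column [j] marks rows [0] and [j + 1]: four pairs sharing row [0], the centre
    [s]. *)
Definition star (s : bitseq) : seq bitseq :=
  map (xorseq s)
    [:: [:: false; false; false; false];
        [:: false; true; true; true];
        [:: true; false; true; true];
        [:: true; true; false; true];
        [:: true; true; true; false]].

Definition transpose (k : nat) (cs : seq bitseq) : seq bitseq :=
  mkseq (fun i => [seq nth false c i | c <- cs]) k.

(** Found by exhaustive search. The centre is sought among the rows because it is itself a member of
    its star; only inclusion is tested, and counting later turns it into equality. *)
Lemma covering_family_star (cs : seq bitseq) :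
  cs \in covering_families 5 4 ->
  exists2 s, s \in transpose 5 cs & {subset star s <= transpose 5 cs}.
Proof.
have /allP h : all (fun cs => has (fun s => all (mem (transpose 5 cs)) (star s))
    (transpose 5 cs)) (covering_families 5 4) by vm_compute.
by move=> /h /hasP[s sI /allP sub]; exists s.
Qed.

Definition covers3 (L : seq bitseq) : bool :=
  all (fun t : nat * nat * nat =>
    all (fun v => has (fun r =>
      [:: nth false r t.1.1; nth false r t.1.2; nth false r t.2] == v) L)
    (bitseqs 3))
  [:: (0, 1, 2); (0, 1, 3); (0, 2, 3); (1, 2, 3)].

(** On three columns a star is its centre plus [111] and the vectors of even weight. Two stars cover
    everything there only if their centres differ in an odd number of these columns; odd on all four
    triples means differing everywhere. The code checks all 256 pairs. *)
Lemma covers3_star (s s' : bitseq) :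
  size s = 4 -> size s' = 4 -> covers3 (star s ++ star s') -> s' = map negb s.
Proof.
have /allP h : all (fun s => all (fun s' => covers3 (star s ++ star s') ==>
    (s' == map negb s)) (bitseqs 4)) (bitseqs 4) by vm_compute.
move=> ss ss' cov.
have /h /allP h' : s \in bitseqs 4 by rewrite -ss mem_bitseqs.
have /h' : s' \in bitseqs 4 by rewrite -ss' mem_bitseqs.
by rewrite cov => /eqP.
Qed.

Definition ca_row (i : nat) : bitseq := map (eq_op^~ 1) (nth [::] ca_10_5_rows i).

(** The first five tails of the target are the offsets used in [star]; the last five are their
    complements, and the complement is absorbed into the centre. *)
Lemma ca_row_star (s : bitseq) (i : nat) : size s = 4 -> i < 10 ->
  xorseq s (behead (ca_row i)) \in star (if i < 5 then s else map negb s).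
Proof.
have /allP h : all (fun s => all (fun i => xorseq s (behead (ca_row i))
    \in star (if i < 5 then s else map negb s)) (iota 0 10)) (bitseqs 4)
  by vm_compute.
move=> ss i10; have /h /allP -> // : s \in bitseqs 4 by rewrite -ss mem_bitseqs.
by rewrite mem_iota.
Qed.

Lemma ca_10_5E (i : 'I_10) (j : 'I_5) : ca_10_5 i j = nth false (ca_row i) j.
Proof.
rewrite mxE /ca_row (nth_map 0) //.
have /allP h : all (fun r => size r == 5) ca_10_5_rows by [].
by rewrite (eqP (h _ (mem_nth _ _))).
Qed.

Lemma ca_10_5_row_inj (i i' : 'I_10) : ca_10_5 i =1 ca_10_5 i' -> i = i'.
Proof.
move=> e; apply/val_inj/eqP => /=.
have u : uniq (mkseq ca_row 10) by vm_compute.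
have sz k : k < 10 -> size (ca_row k) = 5.
  by do 10![case: k => [|k] //].
rewrite -(nth_uniq [::] _ _ u) ?size_mkseq //; apply/eqP.
rewrite !nth_mkseq //; apply: (@eq_from_nth _ false) => [|j]; rewrite !sz //.
by move=> j5; have := e (Ordinal j5); rewrite !ca_10_5E.
Qed.

(** * Equivalences from column complements and row matchings *)

Section Equivalence.

Variables (m n : nat).
Implicit Types A B C : 'M[bool]_(m, n).

Lemma ca_equiv_compl_cols A (js : seq 'I_n) :
  ca_equiv A (foldr (@compl_col m n) A js).
Proof. by elim: js => [|j js IH] /=; constructor. Qed.

Lemma compl_colsE A (js : seq 'I_n) i j : uniq js ->
  foldr (@compl_col m n) A js i j = A i j (+) (j \in js).
Proof.
elim: js => [|j0 js IH] /=; first by rewrite addbF.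
move=> /andP[j0js /IH e]; rewrite mxE e inE.
by case: eqP => [->|//]; rewrite (negbTE j0js) addbF addbT.
Qed.

(** As the rows of [C] are distinct, a choice of matching rows in [B] is injective, hence a
    permutation of the indices. *)
Lemma ca_equiv_rows A B C :
  (forall i i', C i =1 C i' -> i = i') -> (forall i, exists k, B k =1 C i) ->
  ca_equiv A B -> ca_equiv A C.
Proof.
move=> Cinj /fin_all_exists[f fE] AB.
have finj : injective f by move=> i i' e; apply: Cinj => j; rewrite -!fE e.
have -> : C = row_perm (perm finj) B by apply/matrixP=> i j; rewrite mxE permE fE.
by constructor.
Qed.

End Equivalence.

(** * The two halves cut out by the first column *)

Section Halves.

Variables (A : 'M[bool]_(10, 5)) (hA : covering_array 3 A).

Let half (b : bool) : seq 'I_10 := enum [pred i | A i ord0 == b].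

Let tail (i : 'I_10) : 4.-tuple bool := [tuple A i (lift ord0 j) | j < 4].

Let half_col (b : bool) (j : 'I_4) : bitseq := [seq A i (lift ord0 j) | i <- half b].

Lemma covering_array3P (j1 j2 j3 : 'I_5) (a1 a2 a3 : bool) :
  uniq [:: j1; j2; j3] ->
  exists i, [/\ A i j1 = a1, A i j2 = a2 & A i j3 = a3].
Proof.
move=> u; have inj : injective (tnth [tuple j1; j2; j3]) by apply/tuple_uniqP.
have [i hi] := hA _ (tnth [tuple a1; a2; a3]) inj; exists i.
by split; [have := hi (inord 0) | have := hi (inord 1) | have := hi (inord 2)];
  rewrite !(tnth_nth j1) !(tnth_nth a1) /= inordK.
Qed.

Lemma half_col_covers2 b (j j' : 'I_4) : j != j' -> covers2 (half_col b j) (half_col b j').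
Proof.
move=> jj'; apply/allP=> -[a a'] _.
have u : uniq [:: ord0; lift ord0 j; lift ord0 j'].
  by rewrite !cons_uniq !inE negb_or !neq_lift (inj_eq lift_inj) jj'.
have [i [ib ia ia']] := covering_array3P _ _ _ b a a' u.
rewrite /half_col zip_map -ia -ia'.
by apply/mapP; exists i => //; rewrite mem_enum inE ib.
Qed.

Lemma half_cols_family b :
  [seq half_col b j | j <- enum 'I_4] \in covering_families (size (half b)) 4.
Proof.
have sz : size [seq half_col b j | j <- enum 'I_4] = 4.
  by rewrite size_map size_enum_ord.
rewrite -[X in covering_families _ X]sz; apply: mem_covering_families.
  by apply/allP=> _ /mapP[j _ ->]; rewrite size_map.
rewrite pairwise_map; have := enum_uniq 'I_4; rewrite uniq_pairwise.
by apply: sub_pairwise => j j'; apply: half_col_covers2.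
Qed.

Lemma size_half b : size (half b) = 5.
Proof.
have ge5 b' : 5 <= size (half b').
  rewrite leqNgt; apply/negP => /covering_families_small e.
  by have := half_cols_family b'; rewrite e.
have : size (half b) + size (half (~~ b)) = 10.
  rewrite -!cardE -[RHS](card_ord 10) -[RHS](cardC [pred i | A i ord0 == b]).
  congr (_ + _); apply: eq_card => i.
  by rewrite !inE; case: (A i ord0); case: b.
by move=> e; apply/eqP; rewrite eqn_leq ge5 -(leq_add2r 5) -[5 + 5]e leq_add2l ge5.
Qed.

Lemma transpose_half b :
  transpose 5 [seq half_col b j | j <- enum 'I_4] = [seq val (tail i) | i <- half b].
Proof.
apply: (@eq_from_nth _ [::]) => [|k]; rewrite size_mkseq ?size_map ?size_half // => k5.
rewrite nth_mkseq // (nth_map ord0) ?size_half // -map_comp.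
by apply: eq_map => j /=; rewrite (nth_map ord0) ?size_half.
Qed.

Lemma half_star b : exists2 s : bitseq, size s = 4 &
  star s =i [seq val (tail i) | i <- half b].
Proof.
have := half_cols_family b; rewrite size_half => /covering_family_star.
rewrite transpose_half => -[s /mapP[i _ ->] sub].
have ss := size_tuple (tail i); exists (tail i) => //.
have u : uniq (star (tail i)).
  have /allP h : all (fun s => uniq (star s)) (bitseqs 4) by vm_compute.
  by apply: h; rewrite -[X in bitseqs X]ss mem_bitseqs.
have le : size [seq val (tail i) | i <- half b] <= size (star (tail i)).
  by rewrite size_map size_half.
(* Five distinct rows included in a list of length five exhaust it. *)
by have [] := uniq_min_size u sub le.
Qed.

Lemma tail_covers3 (L : seq bitseq) : (forall i, val (tail i) \in L) -> covers3 L.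
Proof.
move=> hL; apply/allP=> -[[j1 j2] j3] jP.
have /and4P[j14 j24 j34 u] : [&& j1 < 4, j2 < 4, j3 < 4 & uniq [:: j1; j2; j3]].
  have /allP h : all (fun t : nat * nat * nat =>
    [&& t.1.1 < 4, t.1.2 < 4, t.2 < 4 & uniq [:: t.1.1; t.1.2; t.2]])
    [:: (0, 1, 2); (0, 1, 3); (0, 2, 3); (1, 2, 3)] by [].
  exact: h jP.
apply/allP=> v vP.
have {vP} [a1 [a2 [a3 ->]]] : exists a1 a2 a3, v = [:: a1; a2; a3].
  by move: vP; rewrite !inE; do 7?[case/orP]; move/eqP->; do 3!eexists.
have [|i [e1 e2 e3]] := covering_array3P (lift ord0 (Ordinal j14))
  (lift ord0 (Ordinal j24)) (lift ord0 (Ordinal j34)) a1 a2 a3.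
  by rewrite -[X in uniq X]/(map (lift ord0) [:: Ordinal j14; _; _])
     (map_inj_uniq lift_inj) -(map_inj_uniq val_inj).
have tE j (j4 : j < 4) : nth false (tail i) j = A i (lift ord0 (Ordinal j4)).
  by rewrite -[j]/(val (Ordinal j4)) -tnth_nth tnth_mktuple.
by apply/hasP; exists (val (tail i)); rewrite ?hL // !tE e1 e2 e3.
Qed.

Lemma ca_row_complement : exists2 s : bitseq, size s = 4 &
  forall i : 'I_10, exists k,
    A k ord0 = nth false (ca_row i) 0 /\
    val (tail k) = xorseq s (behead (ca_row i)).
Proof.
have [s ss es] := half_star true.
have [s' ss' es'] := half_star false.
have e : s' = map negb s.
  apply: covers3_star => //; apply: tail_covers3 => i.
  rewrite mem_cat es es'; case Ai: (A i ord0); apply/orP; [left | right].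
    by apply/mapP; exists i => //; rewrite mem_enum inE Ai.
  by apply/mapP; exists i => //; rewrite mem_enum inE Ai.
exists s => // i.
(* The first entry of the target is 1 exactly in rows 0 to 4, so row [i] is sought in the half
   labelled [i < 5]. *)
have : xorseq s (behead (ca_row i)) \in [seq val (tail k) | k <- half (i < 5)].
  have := ca_row_star s i ss (ltn_ord i).
  by case: (i < 5); rewrite ?es // -e es'.
case/mapP=> k; rewrite mem_enum inE => /eqP Ak ->; exists k; split=> //.
by rewrite Ak; case: i {Ak} => i /=; do 10![case: i => [|i] //].
Qed.

End Halves.

Theorem theorem5p4 (A : 'M[bool]_(10, 5)) (hA : covering_array 3 A) :
  ca_equiv A ca_10_5.
Proof.
have [s ss hs] := ca_row_complement A hA.
(* The prepended [false] leaves the first column uncomplemented. *)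
pose js := [seq j : 'I_5 <- enum 'I_5 | nth false (false :: s) j].
have jsE j : (j \in js) = nth false (false :: s) j by rewrite mem_filter mem_enum andbT.
apply: (ca_equiv_rows _ _ _ _ _ ca_10_5_row_inj _ (ca_equiv_compl_cols _ _ A js)) => i.
have [k [Ak0 Ak]] := hs i; exists k => j.
rewrite compl_colsE ?jsE ?ca_10_5E; last exact/filter_uniq/enum_uniq.
case: (unliftP ord0 j) => [j' ->|->]; last by rewrite Ak0 addbF.
have -> : A k (lift ord0 j') = nth false (xorseq s (behead (ca_row i))) j'.
  by rewrite -Ak -tnth_nth tnth_mktuple.
have sz : size (behead (ca_row i)) = 4.
  by case: i {Ak0 Ak} => i /=; do 10![case: i => [|i] //].
rewrite (nth_map (false, false)) ?size_zip ?sz ?ss ?ltn_ord //.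
(* The complementation adds [s] a second time, so it cancels. *)
by rewrite nth_zip ?sz ?ss // lift0 /= nth_behead addbAC addbb.
Qed.
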